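(* Let $D=\{2^i\mid i\in\mathbb{Z}_{\ge 0}\}$. For every positive integer $k$, \[ \Delta(D,k)\ge \left(\sqrt{\frac{8k-5}{12}}-\frac12\right)2^{\left(\sqrt{\frac{8k-5}{3}}-3\right)}. \]
   Context: For a set $D$ of positive integers, a $D$-diffsequence of length $k$ is a sequence of positive integers $a_1<\dots<a_k$ with $a_{i+1}-a_i\in D$ for all $i\in\{1,\dots,k-1\}$. A $2$-coloring of $\{1,\dots,n\}$ is a map $\chi:\{1,\dots,n\}\to\{0,1\}$; a diffsequence is monochromatic if $\chi$ is constant on its terms. $\Delta(D,k)$ denotes the smallest positive integer $n$ such that every $2$-coloring of $\{1,\dots,n\}$ contains a monochromatic $D$-diffsequence of length $k$. *)

(* Defs.v *)
From mathcomp Require Import all_boot.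
From mathcomp Require Import boolp classical_sets.

Set Implicit Arguments.
Unset Strict Implicit.
Unset Printing Implicit Defensive.

Local Open Scope nat_scope.
Local Open Scope classical_set_scope.

(* The sequence a_1 < ... < a_k is [s], with k = size s and a_(i+1) = nth 0 s i.
   The truncated subtraction below is exact because the terms increase. *)
Definition diffsequence (D : set nat) (s : seq nat) : Prop :=
  (forall a, a \in s -> 0 < a) /\
  (forall i, i.+1 < size s ->
     nth 0 s i < nth 0 s i.+1 /\ D (nth 0 s i.+1 - nth 0 s i)).

Definition monochromatic (chi : nat -> bool) (s : seq nat) : Prop :=
  exists c : bool, forall a, a \in s -> chi a = c.

(* A coloring of {1, ..., n} is given by a total map [chi : nat -> bool]; since
   all the terms of [s] lie in {1, ..., n}, only its values there matter. *)
Definition unavoidable (D : set nat) (k n : nat) : Prop :=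
  forall chi : nat -> bool, exists s : seq nat,
    [/\ size s = k, diffsequence D s, monochromatic chi s &
        forall a, a \in s -> 1 <= a <= n].

Definition is_Delta (D : set nat) (k n : nat) : Prop :=
  [/\ 0 < n, unavoidable D k n &
      forall m, 0 < m -> unavoidable D k m -> n <= m].

(* Takes the value 0 if no such integer exists; by [DeltaP_pow2] below this does
   not happen for the powers of 2. *)
Definition Delta (D : set nat) (k : nat) : nat := xget 0 (is_Delta D k).

Definition pow2 : set nat := [set 2 ^ i | i in [set: nat]].

Lemma is_Delta_unique D k m n : is_Delta D k m -> is_Delta D k n -> m = n.
Proof.
move=> [m0 um mmin] [n0 un nmin].
by apply/eqP; rewrite eqn_leq mmin // nmin.
Qed.

Lemma DeltaP D k n : 0 < n -> unavoidable D k n -> is_Delta D k (Delta D k).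
Proof.
move=> n0 un; apply: xgetPex.
have ex : exists m, `[< 0 < m /\ unavoidable D k m >] by exists n; apply/asboolP.
case: (ex_minnP ex) => m /asboolP[m0 um] mmin.
by exists m; split=> // p p0 up; apply: mmin; apply/asboolP.
Qed.

Lemma unavoidable_pow2 k : unavoidable pow2 k (2 ^ k).-1.
Proof.
case: k => [|k] chi.
  by exists [::]; split=> //; exists true.
elim: k => [|k [s [sz [spos sD] [c sc] sn]]].
  exists [:: 1]; split=> //.
  - by split=> [a|[]//]; rewrite inE => /eqP->.
  - by exists (chi 1) => a; rewrite inE => /eqP->.
  - by move=> a; rewrite inE => /eqP->.
set a := last 0 s.
have aE : a = nth 0 s k by rewrite /a -nth_last sz.
have as_ : a \in s by rewrite aE mem_nth // sz.
have a0 := spos _ as_.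
have /andP[_ an] := sn _ as_.
have bnd i : i < k.+2 -> 1 <= a + 2 ^ i <= (2 ^ k.+2).-1.
  move=> ik; rewrite addn_gt0 a0 /= -ltnS prednK ?expn_gt0 //.
  rewrite [X in _ < X]expnS mul2n -addnn -addSn leq_add ?leq_pexp2l //.
  by rewrite -[X in _ < X]prednK ?expn_gt0.
case: (pselect (exists2 i, i < k.+2 & chi (a + 2 ^ i) = c)) => [[i ik ci]|no].
  exists (rcons s (a + 2 ^ i)); split.
  - by rewrite size_rcons sz.
  - split=> [x|j]; rewrite ?size_rcons ?sz.
      by rewrite mem_rcons inE => /predU1P[->|/spos//]; rewrite addn_gt0 a0.
    rewrite ltnS leq_eqVlt => /predU1P[jk|jk].
      have -> : j = k by case: jk.
      rewrite !nth_rcons sz ltnSn ltnn eqxx -aE addKn.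
      by rewrite -[X in X < _]addn0 ltn_add2l expn_gt0; split=> //; exists i.
    by rewrite !nth_rcons sz jk (ltnW jk); apply: sD; rewrite sz.
  - by exists c => x; rewrite mem_rcons inE => /predU1P[->|/sc].
  - move=> x; rewrite mem_rcons inE => /predU1P[->|/sn/andP[-> xn]] /=.
      exact: bnd.
    by apply: leq_trans xn _; rewrite -!subn1 leq_sub2r // leq_exp2l.
have mem x : x \in mkseq (fun i => a + 2 ^ i) k.+2 ->
    exists2 i, i < k.+2 & x = a + 2 ^ i.
  by move=> /mapP[i]; rewrite mem_iota => /andP[_ ik] ->; exists i.
exists (mkseq (fun i => a + 2 ^ i) k.+2); split.
- by rewrite size_mkseq.
- split=> [x /mem[i ik ->]|i]; first by rewrite addn_gt0 a0.
  rewrite size_mkseq => ik; rewrite !nth_mkseq ?(ltnW ik) //; split.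
    by rewrite ltn_add2l ltn_exp2l.
  by rewrite subnDl expnS mul2n -addnn addnK; exists i.
- exists (~~ c) => x /mem[i ik ->].
  case: (eqVneq (chi (a + 2 ^ i)) c) => [e|]; first by case: no; exists i.
  by case: (chi _); case: (c).
- by move=> x /mem[i ik ->]; apply: bnd.
Qed.

Lemma DeltaP_pow2 k : 0 < k -> is_Delta pow2 k (Delta pow2 k).
Proof.
case: k => // k _; apply: (@DeltaP _ _ (2 ^ k.+1).-1); last exact: unavoidable_pow2.
by rewrite -ltnS prednK ?expn_gt0 // -[X in X < _](expn0 2) ltn_exp2l.
Qed.

(* Main.v *)
(** Write x < 4^m Q in base 4, with m digits 2 h + l (h, l bits) below a leading
    part q < Q, and color x by the parity of q plus the number of digits with l = 1.
    A monochromatic step of length a power of 2 sets an h bit, or carries an l bit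
    at least one digit up while clearing h bits (a carry that clears several h bits
    also clears or moves l bits), or adds at least 2 to q.  Charging each bit l = 1
    three units for every position it can still travel, and counting one unit for
    each bit h = 1, gives a potential that increases strictly, whence
    2 k <= 3 m^2 + 5 m + Q + 1 for a monochromatic diffsequence of length k.
    The parameters are chosen by writing the square root s of (8 k - 5) / 3 as
    2 m + t with 3 <= t < 5 (or m = 0 and 1 <= t < 3). *)
Require Import Defs.
From mathcomp Require Import all_boot all_order all_algebra.
From mathcomp Require Import all_classical all_reals all_analysis.
From mathcomp Require Import zify ring lra.
Import Order.TTheory GRing.Theory Num.Theory.

Fixpoint digit_color (m x : nat) : bool :=
  if m is m'.+1 then odd x (+) digit_color m' x./2./2 else odd x.

(** The charge for l = 1 is written as a credit for l = 0, so that the potential stays in [nat]. *)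
Fixpoint height (m x : nat) : nat :=
  if m is m'.+1 then 3 * m * ~~ odd x + odd x./2 + height m' x./2./2 else x./2.

Lemma digit_colorS (m y : nat) (h l : bool) :
  digit_color m.+1 (4 * y + 2 * h + l) = l (+) digit_color m y.
Proof. by congr (_ (+) digit_color m _); lia. Qed.

Lemma heightS (m y : nat) (h l : bool) :
  height m.+1 (4 * y + 2 * h + l) = 3 * m.+1 * ~~ l + h + height m y.
Proof. by congr (_ * ~~ _ + nat_of_bool _ + height m _); lia. Qed.

(* When digit 3 overflows the next digits absorb a carry, with or without a color
   change; the two bounds have to be proved together. *)
Lemma height_succ (m x : nat) :
  if digit_color m x.+1 == digit_color m x then height m x + 2 <= height m x.+1
  else height m x <= height m x.+1 + 3 * m.
Proof.
elim: m x => [|m IH] x; first by rewrite /=; case: (odd x) => /=; lia.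
have [y [h [l ->]]] : exists y (h l : bool), x = 4 * y + 2 * h + l.
  by exists x./2./2, (odd x./2), (odd x); lia.
case: l; last first.
  have -> : (4 * y + 2 * h + false).+1 = 4 * y + 2 * h + true by lia.
  by rewrite !digit_colorS !heightS; case: (digit_color m y) => /=; lia.
case: h; last first.
  have -> : (4 * y + 2 * false + true).+1 = 4 * y + 2 * true + false by lia.
  by rewrite !digit_colorS !heightS; case: (digit_color m y) => /=; lia.
have -> : (4 * y + 2 * true + true).+1 = 4 * y.+1 + 2 * false + false by lia.
rewrite !digit_colorS !heightS; have := IH y.
(* Clearing l earns 3 (m + 1) and clearing h costs 1; a carry that flips the color of y costs at
   most 3 m, so at least 2 remains. *)
by case: (digit_color m y.+1); case: (digit_color m y) => /=; lia.
Qed.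

Lemma height_step (m x i : nat) :
  digit_color m (x + 2 ^ i) = digit_color m x -> height m x < height m (x + 2 ^ i).
Proof.
elim: m x i => [|m IH] x i.
  case: i => [|i] /=; first by rewrite expn0; lia.
  by rewrite expnS; have := expn_gt0 2 i; lia.
case: i => [|[|i]].
- rewrite expn0 addn1 => e; have := height_succ m.+1 x.
  by rewrite e eqxx; lia.
- rewrite expn1 /=.
  have -> : odd (x + 2) = odd x by lia.
  have -> : (x + 2)./2 = x./2.+1 by lia.
  case: (boolP (odd x./2)) => h; last first.
    have -> : odd x./2.+1 by lia.
    have -> : x./2.+1./2 = x./2./2 by lia.
    by lia.
  have -> : odd x./2.+1 = false by lia.
  have -> : x./2.+1./2 = x./2./2.+1 by lia.
  (* The gain of 2 from the carry outweighs the cleared h bit. *)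
  by move=> /addbI e; have := height_succ m x./2./2; rewrite e eqxx; lia.
- rewrite !expnS /=.
  have -> : odd (x + 2 * (2 * 2 ^ i)) = odd x by lia.
  have -> : (x + 2 * (2 * 2 ^ i))./2 = x./2 + 2 * 2 ^ i by lia.
  have -> : odd (x./2 + 2 * 2 ^ i) = odd x./2 by lia.
  have -> : (x./2 + 2 * 2 ^ i)./2 = x./2./2 + 2 ^ i by lia.
  by move=> /addbI /IH; lia.
Qed.

(** The digit with j - 1 digits above it contributes at most 3 j + 1, and the leading part at most
    (Q - 1) / 2. *)
Lemma height_lt (m Q x : nat) :
  x < 4 ^ m * Q -> 2 * height m x < 3 * m ^ 2 + 5 * m + Q.
Proof.
elim: m x => [|m IH] x /=; first by rewrite mul1n; lia.
rewrite expnS => xQ.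
have /IH : x./2./2 < 4 ^ m * Q by lia.
by rewrite -!mulnn; lia.
Qed.

Lemma Delta_pow2_ge (m Q k : nat) :
  3 * m ^ 2 + 5 * m + Q + 2 <= 2 * k -> 4 ^ m * Q <= Delta pow2 k.
Proof.
move=> mQk.
have k0 : 0 < k by lia.
have [_ /(_ (digit_color m))[s [sz [_ sD] [c sc] sn]] _] := DeltaP_pow2 k0.
rewrite leqNgt; apply/negP => ltN.
have height_ge i : i < size s -> i <= height m (nth 0 s i).
  elim: i => // i IH is_; apply: (leq_ltn_trans (IH (ltnW is_))).
  have [lt_s [j _ ej]] := sD i is_.
  have := height_step m (nth 0 s i) j.
  rewrite ej subnKC ?(ltnW lt_s)//; apply.
  by rewrite !sc ?mem_nth// ltnW.
have last_lt : k.-1 < size s by rewrite sz prednK.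
have := height_ge _ last_lt.
have /sn/andP[_ sDelta] := mem_nth 0 last_lt.
have := height_lt m Q (nth 0 s k.-1) (leq_ltn_trans sDelta ltN).
by lia.
Qed.

Local Open Scope ring_scope.

Lemma powR2_le (R : realType) (t : R) (n : nat) : t <= n%:R -> 2 `^ t <= 2 ^+ n.
Proof. by move=> tn; rewrite -powR_mulrn// ler_powR// ler1n. Qed.

Lemma bound_le (R : realType) (m : nat) (t : R) :
  1 <= t -> (3 <= t \/ m = 0) -> t <= 5 ->
  (2 * m%:R + t - 1) / 2 * 2 `^ (2 * m%:R + t - 3)
  <= 4 ^+ m * (m%:R * (3 * t - 5) + 3 * (t ^+ 2 - 1) / 4).
Proof.
move=> t1 tm t5.
have m0 : 0 <= m%:R :> R by [].
have -> : 2 `^ (2 * m%:R + t - 3) = 4 ^+ m * 2 `^ t / 8 :> R.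
  rewrite powRB ?pnatr_eq0 ?implybT// powRD ?pnatr_eq0 ?implybT//.
  rewrite -natrM !powR_mulrn// exprM.
  by congr (_ ^+ _ * _ / _); lra.
rewrite [leLHS](_ : _ = 4 ^+ m * ((2 * m%:R + t - 1) * 2 `^ t / 16)); last by field.
rewrite ler_pM2l ?exprn_gt0//.
(* This crude bound suffices once t >= 3: the coefficient of m is 2 * 32 / 16 = 4 on the left and 3
   t - 5 >= 4 on the right. *)
have p5 : 2 `^ t <= 32 by apply: le_trans (powR2_le _ _ 5 t5) _; lra.
have p0 : 0 <= 2 `^ t by apply: powR_ge0.
case: (lerP 3 t) => t3; first by nra.
case: tm => [|->]; first lra.
have p3 : 2 `^ t <= 8 by apply: le_trans (powR2_le _ _ 3 (ltW t3)) _; lra.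
by nra.
Qed.

Theorem theorem1 (R : realType) (k : nat) (hk : (0 < k)%N) :
  (Num.sqrt ((8 * k%:R - 5) / 12) - 1 / 2)
    * 2 `^ (Num.sqrt ((8 * k%:R - 5) / 3) - 3)
  <= (Delta pow2 k)%:R :> R.
Proof.
have k1 : 1 <= k%:R :> R by rewrite ler1n.
have -> : (8 * k%:R - 5) / 12 = (8 * k%:R - 5) / 3 * (1 / 2) ^+ 2 :> R by field.
rewrite sqrtrM ?sqrtr_sqr; last by lra.
rewrite ger0_norm//.
have : Num.sqrt ((8 * k%:R - 5) / 3) ^+ 2 = (8 * k%:R - 5) / 3 :> R.
  by rewrite sqr_sqrtr//; lra.
have := sqrtr_ge0 ((8 * k%:R - 5) / 3 : R).
set s := Num.sqrt ((8 * k%:R - 5) / 3) => s0 s2.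
have s1 : 1 <= s by nra.
have [m [t [st t1 tm t5]]] : exists (m : nat) (t : R),
    [/\ s = 2 * m%:R + t, 1 <= t, 3 <= t \/ m = 0 & t <= 5].
  case: (lerP 3 s) => s3; last by exists 0, s; split; [lra|lra|right|lra].
  have /truncn_itv/andP[] : 0 <= (s - 3) / 2 by lra.
  set m := Num.truncn _; rewrite -natr1 => lem ltm.
  by exists m, (s - 2 * m%:R); split; [lra|lra|left; lra|lra].
have m0 : 0 <= m%:R :> R by [].
(* Substituting s = 2 m + t in 2 k = (3 s^2 + 5) / 4 shows that the parenthesized term is exactly
   the largest Q that [Delta_pow2_ge] admits. *)
have kE : 2 * k%:R = 3 * m%:R ^+ 2 + 5 * m%:R
    + (m%:R * (3 * t - 5) + 3 * (t ^+ 2 - 1) / 4) + 2 :> R.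
  by move: s2; rewrite st => s2; nra.
have Q0 : 0 <= m%:R * (3 * t - 5) + 3 * (t ^+ 2 - 1) / 4.
  by case: tm => [t3|->]; nra.
have mk : (3 * m ^ 2 + 5 * m + 2 <= 2 * k)%N.
  by rewrite -(ler_nat R) !natrD !natrM; lra.
have : (4 ^ m * (2 * k - (3 * m ^ 2 + 5 * m + 2)) <= Delta pow2 k)%N.
  by apply: Delta_pow2_ge; lia.
rewrite -(ler_nat R) natrM natrX natrB// !natrD !natrM => N_le.
apply: le_trans N_le.
have -> : s * (1 / 2) - 1 / 2 = (2 * m%:R + t - 1) / 2 by rewrite st; lra.
rewrite st; apply: le_trans (bound_le _ _ _ t1 tm t5) _.
by rewrite ler_pM2l ?exprn_gt0//; lra.
Qed.
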